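(* For each $m\in\{2,3,4,5\}$, let $\mathbb{T}^m=(\mathbb{R}/2\pi\mathbb{Z})^m$ be the $m$-torus and let $q_m=\frac{m(m+3)}{2}$. Then $\mathrm{Free}^\infty(\mathbb{T}^m,\mathbb{R}^{q_m})\neq\varnothing$, i.e. there exists a $C^\infty$ free map $\mathbb{T}^m\to\mathbb{R}^{q_m}$.
   Context: For a smooth $m$-dimensional manifold $M$ put $q_m=\frac{m(m+3)}{2}$. A map $f\in C^2(M,\mathbb{R}^q)$, $q\ge q_m$, is called free if, in local coordinates $(x^\alpha)_{1\le\alpha\le m}$ on $M$ and linear coordinates $(y^i)_{1\le i\le q}$ on $\mathbb{R}^q$, the osculating matrix $\mathcal{D}f=(\partial_\alpha f^i,\ \partial_{\alpha\beta}f^i)$ formed by the $m$ first partial derivative vectors and the $m(m+1)/2$ second partial derivative vectors ($\alpha\le\beta$) has rank $q_m$ at every point; equivalently, at every point these $q_m$ vectors of $\mathbb{R}^q$ are linearly independent. This condition does not depend on the choice of local coordinates on $M$, and every free map is an immersion. $\mathrm{Free}^k(M,\mathbb{R}^q)$ denotes the set of all free $C^k$ immersions of $M$ into $\mathbb{R}^q$. *)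

(* Defs.v *)
From HB Require Import structures.
From mathcomp Require Import all_boot all_order all_algebra generic_quotient.
From mathcomp Require Import all_classical all_reals all_analysis.
Set Implicit Arguments.
Unset Strict Implicit.
Unset Printing Implicit Defensive.
Import Order.TTheory GRing.Theory Num.Theory.
Import numFieldNormedType.Exports.
Local Open Scope classical_set_scope.
Local Open Scope ring_scope.
Local Open Scope quotient_scope.

Section Torus.
Variable R : realType.

Definition eq_mod2pi (x y : R) : bool := (x - y) / (2 * pi) \is a Num.int.

Lemma eq_mod2pi_refl : reflexive eq_mod2pi.
Proof. by move=> x; rewrite /eq_mod2pi subrr mul0r rpred0. Qed.

Lemma eq_mod2pi_sym : symmetric eq_mod2pi.
Proof. by move=> x y; rewrite /eq_mod2pi -[x - y]opprB mulNr rpredN. Qed.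

Lemma eq_mod2pi_trans : transitive eq_mod2pi.
Proof.
move=> y x z; rewrite /eq_mod2pi => xy yz.
have -> : x - z = (x - y) + (y - z) by rewrite addrA subrK.
by rewrite mulrDl rpredD.
Qed.

Canonical eq_mod2pi_equiv :=
  EquivRel eq_mod2pi eq_mod2pi_refl eq_mod2pi_sym eq_mod2pi_trans.

Definition circle := {eq_quot eq_mod2pi}.

Definition torus (m : nat) := 'I_m -> circle.

(* The covering map R^m -> T^m. The smooth structure of T^m is the one for which
   it is a local diffeomorphism: its local inverses form an atlas of T^m, and in
   these charts a map f on T^m reads f \o torus_proj. *)
Definition torus_proj (m : nat) (x : 'rV[R]_m) : torus m :=
  fun i => \pi_circle (x 0 i).

End Torus.

Section Free.
Variables (R : realType) (m q : nat).

Definition partial (i : 'I_m) (g : 'rV[R]_m -> 'rV[R]_q) : 'rV[R]_m -> 'rV[R]_q :=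
  'D_('e_i) g.

Fixpoint Ck (k : nat) (g : 'rV[R]_m -> 'rV[R]_q) : Prop :=
  continuous g /\
  if k is k'.+1 then
    forall i : 'I_m,
      (forall x, derivable g x 'e_i) /\ Ck k' (partial i g)
  else True.

Definition Coo (g : 'rV[R]_m -> 'rV[R]_q) : Prop := forall k, Ck k g.

Definition le_pairs : {set 'I_m * 'I_m} := [set p : 'I_m * 'I_m | (p.1 <= p.2)%N].

(* The rows are the first partial derivatives, then the second ones for
   alpha <= beta: this is the transpose of the q x q_m layout. *)
Definition osculating_mx (g : 'rV[R]_m -> 'rV[R]_q) (x : 'rV[R]_m) :
    'M[R]_(m + #|le_pairs|, q) :=
  col_mx
    (\matrix_(a < m) partial a g x)
    (\matrix_(k < #|le_pairs|)
       partial (enum_val k).1 (partial (enum_val k).2 g) x).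

End Free.

Definition qdim (m : nat) : nat := (m * (m + 3)) %/ 2.

Definition smooth_torus (R : realType) (m q : nat) (f : torus R m -> 'rV[R]_q) : Prop :=
  Coo (f \o @torus_proj R m).

Definition free_torus (R : realType) (m q : nat) (f : torus R m -> 'rV[R]_q) : Prop :=
  forall x : 'rV[R]_m, \rank (osculating_mx (f \o @torus_proj R m) x) = qdim m.

Definition Freeoo_torus (R : realType) (m q : nat) : set (torus R m -> 'rV[R]_q) :=
  [set f | smooth_torus f /\ free_torus f].
Arguments Freeoo_torus : clear implicits.

(* Main.v *)
Require Import Defs.
From mathcomp Require Import all_boot all_order all_algebra generic_quotient.
From mathcomp Require Import all_classical all_reals all_analysis.
From mathcomp Require Import ring lra.

Local Open Scope classical_set_scope.

(**
A torus of dimension m = d + 1 is written with coordinates (x, y), where x has d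
entries and y is the last angle.  All the maps below are built from waves
  z_a(x, y) = exp(rho_a(y)) exp(i (k_a . x + n_a y + phi_a(y))),
each contributing its real and imaginary parts, together with a few functions
w_j(y) of the last angle; p waves and r functions make a map to R^(2 p + r).

A map to R^q with q = m (m + 3) / 2 is free at a point when no nonzero linear form
on R^q kills its first and second derivatives there.  A linear form is
  sum_a Re(alpha_a z_a) + sum_j c_j w_j,
and with alpha_a z_a = s_a + i t_a (all z_a are nonzero, so s_a = t_a = 0 forces
alpha_a = 0), u_a = rho_a', v_a = n_a + phi_a', the condition becomes a linear system
in (s, t, c) whose coefficients depend on y alone:
  sum_a k_a t_a = 0,    sum_a k_a k_a^T s_a = 0,    sum_a k_a (v_a s_a + u_a t_a) = 0,
  sum_a (u_a s_a - v_a t_a) + sum_j c_j w_j' = 0,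
  sum_a ((u_a' + u_a^2 - v_a^2) s_a - (v_a' + 2 u_a v_a) t_a) + sum_j c_j w_j'' = 0.
This is the content of [wave_torus_free].  It remains to find frequencies and
periodic profiles for which the system is nonsingular for all y.  The obstruction is
that u_a and w_j' have mean zero, hence vanish somewhere.

For d >= 2 the frequencies are the vectors e_i and some e_i + e_j or e_i - e_j, seen as
the vertices and edges of a graph.  For d = 3 (triangle) and d = 4 (complete graph) the
symmetric matrices k_a k_a^T are a basis, hence s = 0, and the first system expresses
t on the vertices by t on the edges.  The third system then has one equation per
vertex; along a cycle it links consecutive edges, and its determinant is
prod p_i +- prod q_i, where p_i, q_i are the differences between the u of an edge and
of its two ends ([cycle3_eq0], [cycle4_eq0]).  For d = 4 one takes p = (C, C, -C, -C)
and q = (S, -S, S, -S) with C = cos y, S = sin y on the 4-cycle; one negative edge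
makes the determinant C^4 + S^4.  The two diagonals have constant modulus and carry
phases phi with v = C and v = S; the last two equations are a rotation in their t.
For d = 3, p and q are the sum and difference of (k, -k, l) and (C, S, -C-S), with
k = cos 2y, l = sin 2y: their products add up to 2 k^2 (1 - l) + l^2 > 0, and a unit
circle in two additional coordinates absorbs the last two equations.

For d = 2 and d = 1 the matrices k_a k_a^T have one linear relation, so s keeps one
degree of freedom, to be removed together with the coefficient c of one function w.
For d = 2 the edges e_1 + e_2 and e_1 - e_2 form a cycle of length 2 that gives t = 0,
and the remaining determinant is 1 - sin(3y) / 2.  For d = 1 it is, up to sign and a
factor 2, (2 S^2 - 1)^2 + S^2 (2 - 5 C / 3).  This construction stops at
m = 5: the d (d + 1) / 2 equations on s can only be independent for at least as many
waves, which use m (m - 1) coordinates, and m (m - 1) <= m (m + 3) / 2 means m <= 5.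
*)

Set Implicit Arguments.
Unset Strict Implicit.
Unset Printing Implicit Defensive.
Import Order.TTheory GRing.Theory Num.Theory.
Import numFieldNormedType.Exports.
Local Open Scope ring_scope.
Local Open Scope quotient_scope.

(** * Exponential-trigonometric functions on the torus *)

Section Expressions.
Variables (R : realType) (m : nat).
Implicit Types (x y : 'rV[R]_m) (k : seq int) (i : 'I_m).

(** A class of functions closed under partial derivatives.  A coordinate is only
available inside a sine or a cosine, through a linear form with integer coefficients:
this makes every expression a function on the torus. *)
Inductive expr : Type :=
| Cst of R
| Add of expr & expr
| Mul of expr & expr
| Exp of expr
| Cos of seq int & expr
| Sin of seq int & expr.

Definition linear_phase k x : R := \sum_(i < m) (k`_i)%:~R * x 0 i.

Fixpoint ev (t : expr) x : R :=
  match t with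
  | Cst r => r
  | Add a b => ev a x + ev b x
  | Mul a b => ev a x * ev b x
  | Exp a => expR (ev a x)
  | Cos k a => cos (linear_phase k x + ev a x)
  | Sin k a => sin (linear_phase k x + ev a x)
  end.

Fixpoint dx i (t : expr) : expr :=
  match t with
  | Cst _ => Cst 0
  | Add a b => Add (dx i a) (dx i b)
  | Mul a b => Add (Mul (dx i a) b) (Mul a (dx i b))
  | Exp a => Mul (dx i a) (Exp a)
  | Cos k a => Mul (Mul (Cst (-1)) (Add (Cst (k`_i)%:~R) (dx i a))) (Sin k a)
  | Sin k a => Mul (Add (Cst (k`_i)%:~R) (dx i a)) (Cos k a)
  end.

Lemma derive_comp1 (g : R -> R) (f : 'rV[R]_m -> R) (dg : R) x :
  differentiable f x -> is_derive (f x) 1 g dg ->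
  differentiable (g \o f) x /\ forall v, 'D_v (g \o f) x = dg * 'D_v f x.
Proof.
move=> df [dg1 dgE].
have dg' : differentiable g (f x) by apply/derivable1_diffP.
have dgf : differentiable (g \o f) x by exact: differentiable_comp.
split=> // v; rewrite !deriveE// diff_comp//= diff1E//.
by rewrite derive1E dgE mulrC.
Qed.

Lemma derive_coord x v j : 'D_v (fun z : 'rV[R]_m => z 0 j) x = v 0 j.
Proof.
have /matrixP/(_ 0 j) := derive_mx (@derivable_id R 'rV[R]_m x v).
by rewrite derive_id mxE => <-.
Qed.

Lemma linear_phase_diff k x :
  differentiable (linear_phase k) x /\
  forall i, 'D_('e_i) (linear_phase k) x = (k`_i)%:~R.
Proof.
have E : linear_phase k =
    \sum_(j < m) ((k`_j)%:~R \*: (fun z : 'rV[R]_m => z 0 j)).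
  by apply/funext => z; rewrite fct_sumE.
have D j : differentiable (fun z : 'rV[R]_m => z 0 j) x.
  exact: differentiable_coord.
split; first by rewrite E; apply: differentiable_sum => j; apply: differentiableZ.
move=> i; rewrite E derive_sum => [|j]; last exact/diff_derivable/differentiableZ.
rewrite (bigD1 i)//= big1 => [|j ji]; rewrite deriveZ ?derive_coord ?mxE;
  try exact: diff_derivable.
  by rewrite !eqxx addr0 /= -[RHS]mulr1.
by rewrite eqxx (negbTE ji) scaler0.
Qed.

Lemma ev_diff t x :
  differentiable (ev t) x /\ forall i, 'D_('e_i) (ev t) x = ev (dx i t) x.
Proof.
elim: t => [r|a [da Da] b [db Db]|a [da Da] b [db Db]|a [da Da]
           |k a [da Da]|k a [da Da]] /=.
- by split=> [|i]; [exact: differentiable_cst|exact: derive_cst].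
- split=> [|i]; first exact: differentiableD.
  by rewrite -Da -Db deriveD//; exact: diff_derivable.
- split=> [|i]; first exact: differentiableM.
  rewrite -Da -Db deriveM//; try exact: diff_derivable.
  by rewrite addrC; congr (_ + _); rewrite mulrC.
- have [dE DE] := derive_comp1 da (is_derive_expR _).
  by split=> // i; rewrite DE Da mulrC.
- have [dl Dl] := linear_phase_diff k x.
  have dD : differentiable (linear_phase k + ev a) x by exact: differentiableD.
  have [dE DE] := derive_comp1 dD (is_derive_cos _).
  split=> // i; move: (DE 'e_i); rewrite deriveD; try exact: diff_derivable.
  by rewrite Dl Da /= => ->; rewrite mulN1r mulNr mulrC mulNr.
- have [dl Dl] := linear_phase_diff k x.
  have dD : differentiable (linear_phase k + ev a) x by exact: differentiableD.
  have [dE DE] := derive_comp1 dD (is_derive_sin _).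
  split=> // i; move: (DE 'e_i); rewrite deriveD; try exact: diff_derivable.
  by rewrite Dl Da /= => ->; rewrite mulrC.
Qed.

Definition row_map q (ts : nat -> expr) x : 'rV[R]_q := \row_j ev (ts j) x.

Lemma row_map_diff q ts x : differentiable (row_map q ts) x.
Proof.
have -> : row_map q ts = \sum_(j < q) (fun z => ev (ts j) z *: delta_mx 0 j).
  by apply/funext => z; rewrite fct_sumE [LHS]row_sum_delta;
     apply: eq_bigr => j _; rewrite mxE.
apply: differentiable_sum => j; apply: differentiableZl.
by have [] := ev_diff (ts j) x.
Qed.

Lemma partial_row_map q ts i :
  partial i (row_map q ts) = row_map q (fun j => dx i (ts j)).
Proof.
apply/funext => x; rewrite /partial derive_mx; last first.
  exact/diff_derivable/row_map_diff.
apply/rowP => j; rewrite !mxE -(ev_diff (ts j) x).2.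
by congr ('D_ _ _ x); apply/funext => z; rewrite mxE.
Qed.

Lemma row_map_smooth q ts : Coo (row_map q ts).
Proof.
move=> k; elim: k ts => [|k IH] ts /=; split=> //.
- by move=> x; exact/differentiable_continuous/row_map_diff.
- by move=> x; exact/differentiable_continuous/row_map_diff.
- move=> i; split=> [x|]; first exact/diff_derivable/row_map_diff.
  by rewrite partial_row_map.
Qed.

(** The value at a point of the torus is read off an arbitrary lift; [torus_fun_proj]
says that the lift does not matter. *)
Definition torus_fun q ts (tau : torus R m) : 'rV[R]_q :=
  row_map q ts (\row_i repr (tau i)).

(** Two points with the same image on the torus cannot be told apart by an expression:
an integer linear form changes by an integer multiple of the period. *)
Lemma ev_periodic t x y :
  (forall i, exists n : int, x 0 i = y 0 i + n%:~R * (2 * pi)) ->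
  ev t x = ev t y.
Proof.
move=> xy.
have lin k : exists n : int, linear_phase k x = linear_phase k y + n%:~R * (2 * pi).
  have [n En] := choice xy.
  exists (\sum_(i < m) k`_i * n i).
  rewrite rmorph_sum/= mulr_suml -big_split/=; apply: eq_bigr => i _.
  by rewrite En mulrDr mulrA rmorphM.
have cis (f : R -> R) (a b : R) (n : int) : periodic f (pi *+ 2) ->
    a = b + n%:~R * (2 * pi) -> f a = f b.
  move=> pf ->; rewrite mulr_natl.
  case: n => n; first by rewrite -pmulrn mulr_natl periodicn.
  rewrite NegzE mulrNz -pmulrn mulNr mulr_natl.
  by rewrite -[LHS](periodicn pf n.+1) subrK.
elim: t => [r|a IHa b IHb|a IHa b IHb|a IHa|k a IHa|k a IHa] //=;
  rewrite ?IHa ?IHb //; have [n En] := lin k.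
- by apply: (@cis _ _ _ n (@cosD2pi R)); rewrite En; ring.
- by apply: (@cis _ _ _ n (@sinD2pi R)); rewrite En; ring.
Qed.

Lemma torus_fun_proj q ts : torus_fun q ts \o @torus_proj R m = row_map q ts.
Proof.
apply/funext => x; rewrite /torus_fun /=; apply/rowP => j; rewrite !mxE.
apply: ev_periodic => i; rewrite mxE /torus_proj.
have /eqmodP : repr (\pi_(circle R) (x 0 i)) = x 0 i %[mod circle R] by rewrite reprK.
move=> /intrP[n En]; exists n; rewrite -En divfK; first by rewrite addrC subrK.
by rewrite mulf_neq0 ?pnatr_eq0// gt_eqF ?pi_gt0.
Qed.

End Expressions.

(** * Freeness and annihilating linear forms *)

(** Full column rank is injectivity of the transpose; in this form the order in which
the second derivatives are listed disappears. *)
Lemma rank_osculating_row_map (R : realType) (m q : nat) (ts : nat -> expr R)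
    (x : 'rV[R]_m) :
  (forall c : nat -> R,
     (forall i : 'I_m, \sum_(j < q) c j * ev (dx i (ts j)) x = 0) ->
     (forall i k : 'I_m, (i <= k)%N ->
        \sum_(j < q) c j * ev (dx i (dx k (ts j))) x = 0) ->
     forall j, (j < q)%N -> c j = 0) ->
  \rank (osculating_mx (row_map q ts) x) = q.
Proof.
move=> inj; rewrite -mxrank_tr; apply/eqP.
apply: inj_row_free => v vO.
have vOE l : \sum_(j < q) v 0 j * osculating_mx (row_map q ts) x l j = 0.
  have /rowP/(_ l) := vO; rewrite !mxE => E; rewrite -[RHS]E.
  by apply: eq_bigr => j _; rewrite !mxE.
pose c n := if insub n is Some j then v 0 j else 0.
have cE (j : 'I_q) : c j = v 0 j by rewrite /c valK.
apply/rowP => j; rewrite mxE -cE; apply: inj => // [i|i k ik].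
- rewrite -[RHS](vOE (lshift _ i)); apply: eq_bigr => l _.
  by rewrite cE /osculating_mx col_mxEu mxE partial_row_map mxE.
- have pik : (i, k) \in le_pairs m by rewrite inE.
  rewrite -[RHS](vOE (rshift _ (enum_rank_in pik (i, k)))).
  apply: eq_bigr => l _; rewrite cE /osculating_mx col_mxEd mxE.
  by rewrite enum_rankK_in//= !partial_row_map mxE.
Qed.

Lemma sum_pairs (V : nmodType) (F : nat -> V) n :
  \sum_(j < n.*2) F j = \sum_(a < n) (F a.*2 + F a.*2.+1).
Proof.
elim: n => [|n IH]; first by rewrite !big_ord0.
by rewrite doubleS !big_ord_recr/= IH addrA.
Qed.

(** * Maps made of waves *)

Section Waves.
Variable R : realType.

Record trig := Trig { sin1 : R; cos1 : R; sin2 : R; cos2 : R }.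

Definition trig_ev (A : trig) (y : R) : R :=
  sin1 A * sin y + cos1 A * cos y + sin2 A * sin (2 * y) + cos2 A * cos (2 * y).

Definition trig_der (A : trig) : trig :=
  Trig (- cos1 A) (sin1 A) (- 2 * cos2 A) (2 * sin2 A).

(** Among d + 1 angles, the harmonics of the last one have frequency (0, ..., 0, n). *)
Definition trig_expr (d : nat) (A : trig) : expr R :=
  let e n := ncons d (0 : int) [:: n] in
  Add (Add (Mul (Cst (sin1 A)) (Sin (e 1) (Cst 0)))
           (Mul (Cst (cos1 A)) (Cos (e 1) (Cst 0))))
      (Add (Mul (Cst (sin2 A)) (Sin (e 2) (Cst 0)))
           (Mul (Cst (cos2 A)) (Cos (e 2) (Cst 0)))).

Section TrigExpr.
Variables (d : nat) (x : 'rV[R]_d.+1).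
Let y := x 0 ord_max.

Lemma linear_phase_ncons (n : nat) :
  linear_phase (ncons d 0 [:: n : int]) x = n%:R * y.
Proof.
rewrite /linear_phase (bigD1 ord_max)//= big1 => [|i id].
  by rewrite addr0 nth_ncons ltnn subnn.
rewrite nth_ncons ltn_neqAle -ltnS ltn_ord andbT.
by rewrite -val_eqE /= in id; rewrite id mul0r.
Qed.

Lemma nth_ncons_lt n i : (i < d)%N -> (ncons d (0 : int) [:: n])`_i = 0.
Proof. by rewrite nth_ncons => ->. Qed.

Lemma trig_expr_dx_lt A (i : 'I_d.+1) : (i < d)%N ->
  ev (dx i (trig_expr d A)) x = 0.
Proof. by move=> id; rewrite /trig_expr /= !nth_ncons_lt//; ring. Qed.

Lemma trig_expr_dx A : ev (dx (@ord_max d) (trig_expr d A)) x = trig_ev (trig_der A) y.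
Proof.
rewrite /trig_expr /= !linear_phase_ncons !mul1r !nth_ncons !ltnn !subnn /= !addr0.
by rewrite /trig_ev /=; ring.
Qed.

Lemma trig_expr_dx2_lt A (i k : 'I_d.+1) : (i < d)%N ->
  ev (dx i (dx k (trig_expr d A))) x = 0.
Proof. by move=> id; rewrite /trig_expr /= !(nth_ncons_lt _ id)//; ring. Qed.

Lemma trig_expr_dx2 A : ev (dx (@ord_max d) (dx (@ord_max d) (trig_expr d A))) x =
  trig_ev (trig_der (trig_der A)) y.
Proof.
rewrite /trig_expr /= !linear_phase_ncons !mul1r !nth_ncons !ltnn !subnn /= !addr0.
by rewrite /trig_ev /=; ring.
Qed.
End TrigExpr.

(** The complex function exp(rho(y) + i (freq . (x, y) + phi(y))), where rho = ampl and
phi = phase; the last entry of freq is the winding number in y. *)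
Record wave := Wave { freq : seq int; ampl : trig; phase : trig }.

Definition cos_wave d w :=
  Mul (Exp (trig_expr d (ampl w))) (Cos (freq w) (trig_expr d (phase w))).
Definition sin_wave d w :=
  Mul (Exp (trig_expr d (ampl w))) (Sin (freq w) (trig_expr d (phase w))).

Definition trig0 := Trig 0 0 0 0.
Definition wave0 := Wave [::] trig0 trig0.

Definition component d ws es (j : nat) : expr R :=
  if (j < (size ws).*2)%N then
    (if odd j then sin_wave else cos_wave) d (nth wave0 ws j./2)
  else trig_expr d (nth trig0 es (j - (size ws).*2)).

Lemma sum_component d ws es (c : nat -> R) (F : expr R -> R) :
  \sum_(j < (size ws).*2 + size es) c j * F (component d ws es j) =
  \sum_(a < size ws) (c a.*2 * F (cos_wave d (nth wave0 ws a)) +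
                      c a.*2.+1 * F (sin_wave d (nth wave0 ws a))) +
  \sum_(j < size es) c ((size ws).*2 + j)%N * F (trig_expr d (nth trig0 es j)).
Proof.
rewrite big_split_ord /=; congr (_ + _); last first.
  apply: eq_bigr => j _.
  by rewrite /component ltnNge leq_addr /= addKn.
rewrite (sum_pairs (fun j => c j * F (component d ws es j))).
apply: eq_bigr => a _; rewrite /component ltn_double ltn_ord ltn_Sdouble ltn_ord.
by rewrite /= odd_double doubleK /= uphalf_double.
Qed.

Definition log_ampl' w y := trig_ev (trig_der (ampl w)) y.
Definition log_ampl'' w y := trig_ev (trig_der (trig_der (ampl w))) y.
Definition phase' d w y := ((freq w)`_d)%:~R + trig_ev (trig_der (phase w)) y.
Definition phase'' w y := trig_ev (trig_der (trig_der (phase w))) y.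

(** The system satisfied by a linear form that kills all first and second derivatives,
in the unknowns s_a + i t_a = alpha_a z_a and c.  The equations come from the
derivatives along x_i, x_i x_j, y, x_i y and y y, in this order. *)
Definition annihilator d (ws : seq wave) (es : seq trig) (y : R) (s t c : nat -> R) :=
  let W a := nth wave0 ws a in
  let k a i : R := ((freq (W a))`_i)%:~R in
  let u a := log_ampl' (W a) y in let u' a := log_ampl'' (W a) y in
  let v a := phase' d (W a) y in let v' a := phase'' (W a) y in
  let e' j := trig_ev (trig_der (nth trig0 es j)) y in
  let e'' j := trig_ev (trig_der (trig_der (nth trig0 es j))) y in
  [/\ forall i, (i < d)%N -> \sum_(0 <= a < size ws) k a i * t a = 0,
      forall i j, (i <= j < d)%N -> \sum_(0 <= a < size ws) k a i * k a j * s a = 0,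
      \sum_(0 <= a < size ws) (u a * s a - v a * t a) +
        \sum_(0 <= j < size es) c j * e' j = 0,
      forall i, (i < d)%N ->
        \sum_(0 <= a < size ws) k a i * (v a * s a + u a * t a) = 0 &
      \sum_(0 <= a < size ws) ((u' a + u a ^+ 2 - v a ^+ 2) * s a -
                          (v' a + 2 * u a * v a) * t a) +
        \sum_(0 <= j < size es) c j * e'' j = 0].

Definition annihilator_trivial d ws es y := forall s t c : nat -> R,
  annihilator d ws es y s t c ->
  (forall a, (a < size ws)%N -> s a = 0 /\ t a = 0) /\
  (forall j, (j < size es)%N -> c j = 0).

(** Derivatives of Re(alpha z) with alpha = c - i c' and z = exp(rho + i theta), in terms
of alpha z = s + i t: differentiating z multiplies it by the derivative of
rho + i theta. *)
Section WaveDerivatives.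
Variables (d : nat) (x : 'rV[R]_d.+1) (w : wave) (c c' : R).
Let s := c * ev (cos_wave d w) x + c' * ev (sin_wave d w) x.
Let t := c * ev (sin_wave d w) x - c' * ev (cos_wave d w) x.
Let rho (i : 'I_d.+1) : R := ev (dx i (trig_expr d (ampl w))) x.
Let theta (i : 'I_d.+1) : R := ((freq w)`_i)%:~R + ev (dx i (trig_expr d (phase w))) x.

Lemma wave_dx (i : 'I_d.+1) :
  c * ev (dx i (cos_wave d w)) x + c' * ev (dx i (sin_wave d w)) x =
  rho i * s - theta i * t.
Proof. by rewrite /s /t /rho /theta /cos_wave /sin_wave /=; ring. Qed.

Lemma wave_dx2 (i k : 'I_d.+1) :
  c * ev (dx i (dx k (cos_wave d w))) x + c' * ev (dx i (dx k (sin_wave d w))) x =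
  (ev (dx i (dx k (trig_expr d (ampl w)))) x + rho i * rho k - theta i * theta k) * s
  - (ev (dx i (dx k (trig_expr d (phase w)))) x + rho i * theta k + theta i * rho k) * t.
Proof. by rewrite /s /t /rho /theta /cos_wave /sin_wave; cbn [ev dx]; ring. Qed.

Lemma wave_eq0 : s = 0 -> t = 0 -> c = 0 /\ c' = 0.
Proof.
move=> s0 t0.
set C := ev (cos_wave d w) x; set S := ev (sin_wave d w) x.
have CS : C ^+ 2 + S ^+ 2 != 0.
  by rewrite /C /S /= !exprMn -mulrDr cos2Dsin2 mulr1 expf_neq0 ?gt_eqF ?expR_gt0//.
have cE : c * (C ^+ 2 + S ^+ 2) = C * s + S * t by rewrite /s /t -/C -/S; ring.
have c'E : c' * (C ^+ 2 + S ^+ 2) = S * s - C * t by rewrite /s /t -/C -/S; ring.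
move: cE c'E; rewrite s0 t0 !mulr0 subr0 addr0 => /eqP + /eqP.
by rewrite !mulf_eq0 (negbTE CS) !orbF => /eqP -> /eqP ->.
Qed.
End WaveDerivatives.

Arguments ev : simpl never.

(** The reduction to one variable: the system depends on x only through the unknowns,
because translating x rotates each wave. *)
Lemma wave_torus_free d (ws : seq wave) (es : seq trig) :
  ((size ws).*2 + size es)%N = qdim d.+1 ->
  (forall y, annihilator_trivial d ws es y) ->
  Freeoo_torus R d.+1 (qdim d.+1) !=set0.
Proof.
move=> qE nondeg; rewrite -qE; set q := (_ + _)%N.
exists (torus_fun q (component d ws es)).
split; rewrite /smooth_torus /free_torus torus_fun_proj.
  exact: row_map_smooth.
move=> x; rewrite -qE; apply: rank_osculating_row_map => c c1 c2.
pose W a := nth wave0 ws a.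
pose s a := c a.*2 * ev (cos_wave d (W a)) x +
            c a.*2.+1 * ev (sin_wave d (W a)) x.
pose t a := c a.*2 * ev (sin_wave d (W a)) x -
            c a.*2.+1 * ev (cos_wave d (W a)) x.
pose b j := c ((size ws).*2 + j)%N.
have {}c1 i := etrans (esym (sum_component d ws es c (fun e => ev (dx i e) x))) (c1 i).
have {}c2 i k ik := etrans (esym (sum_component d ws es c
  (fun e => ev (dx i (dx k e)) x))) (c2 i k ik).
have es_dx0 i F : F + \sum_(j < size es)
    b j * ev (dx (widen_ord (leqnSn d) i) (trig_expr d (nth trig0 es j))) x = F.
  by rewrite big1 ?addr0// => j _; rewrite trig_expr_dx_lt//= mulr0.
have [st0 b0] : (forall a, (a < size ws)%N -> s a = 0 /\ t a = 0) /\
    (forall j, (j < size es)%N -> b j = 0).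
  apply: (nondeg (x 0 ord_max) s t b); split.
  - move=> i id; rewrite big_mkord; have := c1 (widen_ord (leqnSn d) (Ordinal id)).
    rewrite es_dx0 => /eqP; rewrite -oppr_eq0 -sumrN => /eqP E.
    rewrite -[RHS]E; apply: eq_bigr => a _.
    by rewrite wave_dx !trig_expr_dx_lt//= /t /W; ring.
  - move=> i j /andP[ij jd]; rewrite big_mkord; have id := leq_ltn_trans ij jd.
    have := c2 (widen_ord (leqnSn d) (Ordinal id)) (widen_ord (leqnSn d) (Ordinal jd)) ij.
    rewrite [X in _ + X]big1 ?addr0 => [/eqP|l _]; last first.
      by rewrite trig_expr_dx2_lt//= mulr0.
    rewrite -oppr_eq0 -sumrN => /eqP E; rewrite -[RHS]E; apply: eq_bigr => a _.
    by rewrite wave_dx2 !trig_expr_dx2_lt// !trig_expr_dx_lt//= /s /W; ring.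
  - rewrite !big_mkord -[RHS](c1 ord_max); congr (_ + _); apply: eq_bigr => a _.
      by rewrite wave_dx !trig_expr_dx /log_ampl' /phase'.
    by rewrite trig_expr_dx.
  - move=> i id; rewrite big_mkord.
    have := c2 (widen_ord (leqnSn d) (Ordinal id)) ord_max (ltnW id).
    rewrite [X in _ + X]big1 ?addr0 => [/eqP|l _]; last first.
      by rewrite trig_expr_dx2_lt//= mulr0.
    rewrite -oppr_eq0 -sumrN => /eqP E; rewrite -[RHS]E; apply: eq_bigr => a _.
    have id' : (widen_ord (leqnSn d) (Ordinal id) < d)%N by [].
    rewrite wave_dx2 !trig_expr_dx2_lt// !(trig_expr_dx_lt _ _ id') !trig_expr_dx.
    by rewrite /log_ampl' /phase' /s /t /W; ring.
  - rewrite !big_mkord -[RHS](c2 ord_max ord_max (leqnn _)).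
    congr (_ + _); apply: eq_bigr => a _.
      rewrite wave_dx2 !trig_expr_dx2 !trig_expr_dx /log_ampl' /phase'.
      by rewrite /log_ampl'' /phase'' -/(s a) -/(t a); ring.
    by rewrite trig_expr_dx2.
have wave0E a : (a < size ws)%N -> c a.*2 = 0 /\ c a.*2.+1 = 0.
  by move=> /st0[sa ta]; apply: wave_eq0 sa ta.
move=> j jq; case: (ltnP j (size ws).*2) => jw; last first.
  by have := b0 (j - (size ws).*2)%N; rewrite /b subnKC// ltn_subLR//; exact.
have jh : (j./2 < size ws)%N.
  rewrite -ltn_double (leq_ltn_trans _ jw)//.
  by rewrite -{2}(odd_double_half j) leq_addl.
have [e o] := wave0E _ jh.
by rewrite -(odd_double_half j); case: (odd j).
Qed.
End Waves.

(** * Linear systems along a cycle *)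

Section Cycles.
Variable F : fieldType.
Implicit Types p q x : F.

Lemma cycle2_eq0 p1 p2 q1 q2 x1 x2 : p1 * p2 - q1 * q2 != 0 ->
  p1 * x1 + q1 * x2 = 0 -> p2 * x2 + q2 * x1 = 0 -> x1 = 0 /\ x2 = 0.
Proof.
have half (a1 a2 b1 b2 y1 y2 : F) : a1 * a2 - b1 * b2 != 0 ->
    a1 * y1 + b1 * y2 = 0 -> a2 * y2 + b2 * y1 = 0 -> y1 = 0.
  move=> D0 E1 E2; apply: (mulIf D0).
  have -> : y1 * (a1 * a2 - b1 * b2) =
    a2 * (a1 * y1 + b1 * y2) - b1 * (a2 * y2 + b2 * y1) by ring.
  by rewrite E1 E2; ring.
move=> D0 E1 E2; split; first exact: half D0 E1 E2.
by apply: (half p2 p1 q2 q1) E2 E1; rewrite mulrC (mulrC q2).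
Qed.

(** Going once around the cycle multiplies an unknown by -q1 q2 q3 / (p1 p2 p3). *)
Lemma cycle3_eq0 p1 p2 p3 q1 q2 q3 x1 x2 x3 :
  p1 * p2 * p3 + q1 * q2 * q3 != 0 ->
  p1 * x1 + q1 * x2 = 0 -> p2 * x2 + q2 * x3 = 0 -> p3 * x3 + q3 * x1 = 0 ->
  [/\ x1 = 0, x2 = 0 & x3 = 0].
Proof.
have third (a1 a2 a3 b1 b2 b3 y1 y2 y3 : F) :
    a1 * a2 * a3 + b1 * b2 * b3 != 0 -> a1 * y1 + b1 * y2 = 0 ->
    a2 * y2 + b2 * y3 = 0 -> a3 * y3 + b3 * y1 = 0 -> y1 = 0.
  move=> D0 E1 E2 E3; apply: (mulIf D0).
  have -> : y1 * (a1 * a2 * a3 + b1 * b2 * b3) =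
    a2 * a3 * (a1 * y1 + b1 * y2) - b1 * a3 * (a2 * y2 + b2 * y3) +
    b1 * b2 * (a3 * y3 + b3 * y1) by ring.
  by rewrite E1 E2 E3; ring.
have rot (a1 a2 a3 : F) : a1 * a2 * a3 = a2 * a3 * a1 by ring.
move=> D0 E1 E2 E3; have D1 := D0; rewrite rot (rot q1) in D1.
have D2 := D1; rewrite rot (rot q2) in D2.
split; first exact: third D0 E1 E2 E3.
- exact: third D1 E2 E3 E1.
- exact: third D2 E3 E1 E2.
Qed.

(** The parity of the length fixes the sign between the two products. *)
Lemma cycle4_eq0 p1 p2 p3 p4 q1 q2 q3 q4 x1 x2 x3 x4 :
  p1 * p2 * p3 * p4 - q1 * q2 * q3 * q4 != 0 ->
  p1 * x1 + q1 * x2 = 0 -> p2 * x2 + q2 * x3 = 0 ->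
  p3 * x3 + q3 * x4 = 0 -> p4 * x4 + q4 * x1 = 0 ->
  [/\ x1 = 0, x2 = 0, x3 = 0 & x4 = 0].
Proof.
have fourth (a1 a2 a3 a4 b1 b2 b3 b4 y1 y2 y3 y4 : F) :
    a1 * a2 * a3 * a4 - b1 * b2 * b3 * b4 != 0 ->
    a1 * y1 + b1 * y2 = 0 -> a2 * y2 + b2 * y3 = 0 ->
    a3 * y3 + b3 * y4 = 0 -> a4 * y4 + b4 * y1 = 0 -> y1 = 0.
  move=> D0 E1 E2 E3 E4; apply: (mulIf D0).
  have -> : y1 * (a1 * a2 * a3 * a4 - b1 * b2 * b3 * b4) =
    a2 * a3 * a4 * (a1 * y1 + b1 * y2) - b1 * a3 * a4 * (a2 * y2 + b2 * y3) +
    b1 * b2 * a4 * (a3 * y3 + b3 * y4) - b1 * b2 * b3 * (a4 * y4 + b4 * y1) by ring.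
  by rewrite E1 E2 E3 E4; ring.
have rot (a1 a2 a3 a4 : F) : a1 * a2 * a3 * a4 = a2 * a3 * a4 * a1 by ring.
move=> D0 E1 E2 E3 E4; have D1 := D0; rewrite rot (rot q1) in D1.
have D2 := D1; rewrite rot (rot q2) in D2.
have D3 := D2; rewrite rot (rot q3) in D3.
split; first exact: fourth D0 E1 E2 E3 E4.
- exact: fourth D1 E2 E3 E4 E1.
- exact: fourth D2 E3 E4 E1 E2.
- exact: fourth D3 E4 E1 E2 E3.
Qed.
End Cycles.

(** * The four maps *)

Section Maps.
Variable R : realType.

(** The profiles are prescribed through their derivatives. *)
Definition primitive (a b k l : R) : trig R := Trig a (- b) (k / 2) (- l / 2).

Lemma primitive_der a b k l y : trig_ev (trig_der (primitive a b k l)) y =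
  a * cos y + b * sin y + k * cos (2 * y) + l * sin (2 * y).
Proof. by rewrite /trig_ev /=; field. Qed.

Lemma primitive_der2 a b k l y :
  trig_ev (trig_der (trig_der (primitive a b k l))) y =
  b * cos y - a * sin y + 2 * l * cos (2 * y) - 2 * k * sin (2 * y).
Proof. by rewrite /trig_ev /=; field. Qed.

Lemma trig0_der y : trig_ev (trig_der (trig0 R)) y = 0.
Proof. by rewrite /trig_ev /=; ring. Qed.

Lemma trig0_der2 y : trig_ev (trig_der (trig_der (trig0 R))) y = 0.
Proof. by rewrite /trig_ev /=; ring. Qed.

Lemma cos_mul2 (y : R) : cos (2 * y) = cos y ^+ 2 - sin y ^+ 2.
Proof. by rewrite mulr_natl mulr2n cosD !expr2. Qed.

Lemma sin_mul2 (y : R) : sin (2 * y) = 2 * (sin y * cos y).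
Proof. by rewrite mulr_natl mulr2n sinD; ring. Qed.

Arguments trig_ev : simpl never.
Arguments trig0 : simpl never.
Arguments primitive : simpl never.

(* A sum over a numeric range computes once the big operator is unlocked. *)
Ltac explicit :=
  rewrite unlock /= /log_ampl' /log_ampl'' /phase' /phase'' /=
    ?trig0_der ?trig0_der2 ?primitive_der ?primitive_der2 ?cos_mul2 ?sin_mul2.

(** The moduli and w are even functions of y, which makes the determinant a polynomial
in cos y. *)
Definition waves2 : seq (wave R) :=
  [:: Wave [:: 1; 0] (primitive 0 (1/3) 0 0) (trig0 R);
      Wave [:: 4; 1] (primitive 0 (4/3) 0 0) (trig0 R)].

Lemma annihilator2 (y : R) :
  annihilator_trivial 1 waves2 [:: primitive 0 0 0 1] y.
Proof.
move=> s t c [k_t kk_s ys k_y yy].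
move: (k_t 0%N isT) (kk_s 0%N 0%N isT) ys (k_y 0%N isT) yy; explicit.
have := cos2Dsin2 y.
move: (cos y) (sin y) => C S CS kt kks ys ky yy {k_t kk_s k_y}.
have C2 : C ^+ 2 = 1 - S ^+ 2 by lra.
have s0 : s 0%N = - 16 * s 1%N by lra.
have t0 : t 0%N = - 4 * t 1%N by lra.
have s1 : s 1%N = - S * t 1%N by rewrite t0 in ky; lra.
have E1 : (4 * S ^+ 2 - 1) * t 1%N + 2 * S * C * c 0%N = 0.
  by rewrite -[RHS]ys s0 s1; field.
have E2 : 2 * (1 - 2 * S ^+ 2) * c 0%N + S * (4 * C - 5 / 3) * t 1%N = 0.
  by rewrite -[RHS]yy s0 s1 C2; field.
have D0 : 0 < (2 * S ^+ 2 - 1) ^+ 2 + S ^+ 2 * (2 - 5 / 3 * C).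
  have C1 : C <= 1 by clear -CS; nra.
  have : 0 <= S ^+ 2 * (1 - C) by rewrite mulr_ge0 ?sqr_ge0 ?subr_ge0.
  (* 11/24 minimizes (2 x - 1)^2 + x / 3, where x = S^2. *)
  by have := sqr_ge0 (S ^+ 2 - 11 / 24); lra.
have [|t1 c0] := cycle2_eq0 _ E1 E2.
  rewrite [X in X != 0](_ : _ =
    - 2 * ((2 * S ^+ 2 - 1) ^+ 2 + S ^+ 2 * (2 - 5 / 3 * C))); last first.
    have -> : 2 * S * C * (S * (4 * C - 5 / 3)) =
      8 * S ^+ 2 * C ^+ 2 - 10 / 3 * S ^+ 2 * C by field.
    by rewrite C2; field.
  by apply: mulf_neq0; [rewrite oppr_eq0 pnatr_eq0|rewrite gt_eqF].
have s10 : s 1%N = 0 by rewrite s1 t1 mulr0.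
split; last by case.
by do 2?case=> //; rewrite ?s0 ?t0 ?s10 ?t1 !mulr0.
Qed.

Definition waves3 : seq (wave R) :=
  [:: Wave [:: 1; 0; 0]  (primitive 1 0 0 0)             (trig0 R);
      Wave [:: 0; 1; 0]  (trig0 R)                       (trig0 R);
      Wave [:: 1; 1; 0]  (primitive (1/2) (1/2) 0 0)     (trig0 R);
      Wave [:: 1; -1; 0] (primitive (1/2) (- (1/2)) 0 0) (trig0 R)].

Lemma annihilator3 (y : R) :
  annihilator_trivial 2 waves3 [:: primitive 0 1 0 0] y.
Proof.
move=> s t c [k_t kk_s ys k_y yy].
have [s3 s0 s1] : [/\ s 3%N = s 2%N, s 0%N = - 2 * s 2%N & s 1%N = - 2 * s 2%N].
  move: (kk_s 0%N 0%N isT) (kk_s 0%N 1%N isT) (kk_s 1%N 1%N isT).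
  by explicit => *; split; lra.
have [t0 t1] : t 0%N = - (t 2%N + t 3%N) /\ t 1%N = t 3%N - t 2%N.
  by move: (k_t 0%N isT) (k_t 1%N isT); explicit => *; split; lra.
move: (k_y 0%N isT) (k_y 1%N isT) ys yy; explicit.
rewrite ?s3 ?s0 ?s1 ?t0 ?t1; have := cos2Dsin2 y.
move: (cos y) (sin y) => C S CS ky0 ky1 ys yy {k_t kk_s k_y}.
have E1 : (C + S) * t 2%N + (S - C) * t 3%N = 0.
  by rewrite -[RHS](mulr0 2) -ky1; field.
have E2 : (C + S) * t 3%N + (C - S) * t 2%N = 0.
  by rewrite -[RHS](mulr0 (- 2)) -ky0; field.
have [|t2 t3] := cycle2_eq0 _ E1 E2.
  rewrite [X in X != 0](_ : _ = 2 * (C ^+ 2 + S ^+ 2)); last by ring.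
  by rewrite CS mulr1 pnatr_eq0.
have C2 : C ^+ 2 = 1 - S ^+ 2 by rewrite -CS addrK.
have E3 : S * c 0%N + - C * s 2%N = 0 by rewrite -[RHS]ys t2 t3; field.
have E4 : (S - 2 * C ^+ 2 + (C ^+ 2 + S ^+ 2) / 2) * s 2%N + C * c 0%N = 0.
  by rewrite -[RHS]yy t2 t3; field.
have [|c0 s2] := cycle2_eq0 _ E3 E4.
  (* The determinant is 1 - sin (3 y) / 2. *)
  rewrite [X in X != 0](_ : _ = 2 * ((S + 1) * (S - 1 / 2) ^+ 2) + 1 / 2); last first.
    by rewrite mulNr opprK -expr2 C2; field.
  have S1 : -1 <= S by clear -CS; nra.
  have S0 : 0 <= (S + 1) * (S - 1 / 2) ^+ 2 by rewrite mulr_ge0 ?sqr_ge0//; lra.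
  by rewrite gt_eqF//; clear -S0; lra.
split; last by case.
by do 4?case=> //; rewrite ?s0 ?s1 ?s3 ?t0 ?t1 ?t2 ?t3 ?s2 ?mulr0 ?addr0 ?subr0 ?oppr0.
Qed.

Definition waves4 : seq (wave R) :=
  [:: Wave [:: 1; 0; 0; 0] (trig0 R)                (trig0 R);
      Wave [:: 0; 1; 0; 0] (primitive 1 1 2 0)      (trig0 R);
      Wave [:: 0; 0; 1; 0] (primitive 0 1 1 (-1))   (trig0 R);
      Wave [:: 1; 1; 0; 0] (primitive 1 0 1 0)      (trig0 R);
      Wave [:: 1; 0; 1; 0] (primitive (-1) 0 1 0)   (trig0 R);
      Wave [:: 0; 1; 1; 0] (primitive 1 2 1 0)      (trig0 R)].

(** The two functions of y alone trace a unit circle. *)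
Lemma annihilator4 (y : R) :
  annihilator_trivial 3 waves4 [:: primitive 0 1 0 0; primitive 1 0 0 0] y.
Proof.
move=> s t c [k_t kk_s ys k_y yy].
have [[s3 s4 s5] [s0 s1 s2]] : [/\ s 3%N = 0, s 4%N = 0 & s 5%N = 0] /\
    [/\ s 0%N = 0, s 1%N = 0 & s 2%N = 0].
  move: (kk_s 0%N 0%N isT) (kk_s 0%N 1%N isT) (kk_s 0%N 2%N isT)
    (kk_s 1%N 1%N isT) (kk_s 1%N 2%N isT) (kk_s 2%N 2%N isT); explicit => *.
  by split; split; lra.
have [t0 t1 t2] : [/\ t 0%N = - (t 3%N + t 4%N), t 1%N = - (t 3%N + t 5%N) &
    t 2%N = - (t 4%N + t 5%N)].
  by move: (k_t 0%N isT) (k_t 1%N isT) (k_t 2%N isT); explicit => *; split; lra.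
move: ys yy (k_y 0%N isT) (k_y 1%N isT) (k_y 2%N isT); explicit.
rewrite ?t0 ?t1 ?t2 ?s0 ?s1 ?s2 ?s3 ?s4 ?s5.
have := cos2Dsin2 (2 * y); rewrite cos_mul2 sin_mul2; have := cos2Dsin2 y.
move: (cos y) (sin y) => C S CS CS2 ys yy ky0 ky1 ky2 {k_t kk_s k_y}.
pose k := C ^+ 2 - S ^+ 2; pose l := 2 * (S * C).
rewrite -/k -/l in CS2.
have E1 : (k + C) * t 3%N + (k - C) * t 4%N = 0 by rewrite -[RHS]ky0 /k; ring.
have E2 : (l - C - S) * t 4%N + (l + C + S) * t 5%N = 0.
  by rewrite -[RHS]ky2 /k /l; ring.
have E3 : (- k + S) * t 5%N + (- k - S) * t 3%N = 0.
  by rewrite -[RHS]ky1 /k; ring.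
have [|t3 t4 t5] := cycle3_eq0 _ E1 E2 E3.
  rewrite [X in X != 0](_ : _ = 2 * (k ^+ 2 * (1 - l)) + l ^+ 2); last by rewrite /k /l; ring.
  have k2 : k ^+ 2 = 1 - l ^+ 2 by rewrite -CS2 addrK.
  rewrite k2; have [l1 l1'] : -1 <= l /\ l <= 1.
    by have := sqr_ge0 k; rewrite k2; clear; split; nra.
  (* The cubic 2 (1 - l^2) (1 - l) + l^2 has a local minimum close to 77/100. *)
  have l0 : 0 <= (l + 1) * (l - 77 / 100) ^+ 2 by rewrite mulr_ge0 ?sqr_ge0//; lra.
  by have l2 := sqr_ge0 l; rewrite gt_eqF//; clear -l1 l1' l0 l2; lra.
have Ey : S * c 0%N + C * c 1%N = 0 by rewrite -[RHS]ys t3 t4 t5; ring.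
have Eyy : - S * c 1%N + C * c 0%N = 0 by rewrite -[RHS]yy t3 t4 t5; ring.
have [|c0 c1] := cycle2_eq0 _ Ey Eyy.
  by rewrite mulrN -opprD addrC -!expr2 CS oppr_eq0 oner_eq0.
split; last by do 2?case.
by do 6?case=> //; rewrite ?t0 ?t1 ?t2 ?t3 ?t4 ?t5 ?addr0 ?oppr0.
Qed.

(** The four vertices 1, 2, 3, 4 come first, then the edges 12, 23, 34, 41 of the cycle,
then its diagonals 13 and 24. *)
Definition waves5 : seq (wave R) :=
  [:: Wave [:: 1; 0; 0; 0; 0]  (trig0 R)              (trig0 R);
      Wave [:: 0; 1; 0; 0; 0]  (primitive 1 (-1) 0 0) (trig0 R);
      Wave [:: 0; 0; 1; 0; 0]  (primitive 2 0 0 0)    (trig0 R);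
      Wave [:: 0; 0; 0; 1; 0]  (primitive 1 (-1) 0 0) (trig0 R);
      Wave [:: 1; -1; 0; 0; 0] (primitive 1 0 0 0)    (trig0 R);
      Wave [:: 0; 1; 1; 0; 0]  (primitive 2 (-1) 0 0) (trig0 R);
      Wave [:: 0; 0; 1; 1; 0]  (primitive 1 0 0 0)    (trig0 R);
      Wave [:: 1; 0; 0; 1; 0]  (primitive 0 (-1) 0 0) (trig0 R);
      Wave [:: 1; 0; 1; 0; 0]  (trig0 R)              (primitive 1 0 0 0);
      Wave [:: 0; 1; 0; 1; 0]  (trig0 R)              (primitive 0 1 0 0)].

Lemma annihilator5 (y : R) : annihilator_trivial 4 waves5 [::] y.
Proof.
move=> s t c [k_t kk_s ys k_y yy].
have [[s0 s1 s2 s3 s4] [s5 s6 s7 s8 s9]] :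
    [/\ s 0%N = 0, s 1%N = 0, s 2%N = 0, s 3%N = 0 & s 4%N = 0] /\
    [/\ s 5%N = 0, s 6%N = 0, s 7%N = 0, s 8%N = 0 & s 9%N = 0].
  move: (kk_s 0%N 0%N isT) (kk_s 0%N 1%N isT) (kk_s 0%N 2%N isT)
    (kk_s 0%N 3%N isT) (kk_s 1%N 1%N isT) (kk_s 1%N 2%N isT) (kk_s 1%N 3%N isT)
    (kk_s 2%N 2%N isT) (kk_s 2%N 3%N isT) (kk_s 3%N 3%N isT); explicit => *.
  by split; split; lra.
have [t0 t1 t2 t3] : [/\ t 0%N = - (t 4%N + t 7%N + t 8%N),
    t 1%N = t 4%N - t 5%N - t 9%N, t 2%N = - (t 5%N + t 6%N + t 8%N) &
    t 3%N = - (t 6%N + t 7%N + t 9%N)].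
  move: (k_t 0%N isT) (k_t 1%N isT) (k_t 2%N isT) (k_t 3%N isT); explicit => *.
  by split; lra.
move: ys yy (k_y 0%N isT) (k_y 1%N isT) (k_y 2%N isT) (k_y 3%N isT).
explicit; rewrite ?t0 ?t1 ?t2 ?t3 ?s0 ?s1 ?s2 ?s3 ?s4 ?s5 ?s6 ?s7 ?s8 ?s9.
have := cos2Dsin2 y.
move: (cos y) (sin y) => C S CS ys yy ky0 ky1 ky2 ky3 {k_t kk_s k_y}.
have Ey : - C * t 8%N + - S * t 9%N = 0 by rewrite -[RHS]ys; ring.
have Eyy : - C * t 9%N + S * t 8%N = 0 by rewrite -[RHS]yy; ring.
have [|t8 t9] := cycle2_eq0 _ Ey Eyy.
  by rewrite mulrNN mulNr opprK -!expr2 CS oner_eq0.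
have E4 : C * t 4%N + - S * t 7%N = 0 by rewrite -[RHS]ky0 t8; ring.
have E7 : C * t 7%N + - S * t 6%N = 0 by rewrite -[RHS]oppr0 -ky3 t9; ring.
have E6 : C * t 6%N + S * t 5%N = 0 by rewrite -[RHS]oppr0 -ky2 t8; ring.
have E5 : C * t 5%N + - S * t 4%N = 0 by rewrite -[RHS]ky1 t9; ring.
have [|t4 t7 t6 t5] := cycle4_eq0 _ E4 E7 E6 E5.
  rewrite [X in X != 0](_ : _ = (C ^+ 2 + S ^+ 2) ^+ 2 / 2 + (C ^+ 2 - S ^+ 2) ^+ 2 / 2);
    last by field.
  by rewrite CS expr1n gt_eqF// ltr_wpDr ?divr_ge0 ?sqr_ge0 ?divr_gt0.
split; last by case.
by do 10?case=> //;
  rewrite ?t0 ?t1 ?t2 ?t3 ?t4 ?t5 ?t6 ?t7 ?t8 ?t9 ?addr0 ?subr0 ?oppr0.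
Qed.
End Maps.

Theorem mainTheorem1 (R : realType) (m : nat) (hm : m \in [:: 2; 3; 4; 5]%N) :
  Freeoo_torus R m (qdim m) !=set0.
Proof.
move: hm; rewrite !inE => /or4P[] /eqP ->.
- exact: wave_torus_free (@annihilator2 R).
- exact: wave_torus_free (@annihilator3 R).
- exact: wave_torus_free (@annihilator4 R).
- exact: wave_torus_free (@annihilator5 R).
Qed.
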